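(* Let $r\geq2$ be an integer and let $O\subseteq\mathbb{R}^r$ be an open orthant disjoint from $\mathbb{R}^r_{\mathrm{alt}}$. For each matrix $A\in\mathbb{R}^{r\times r}$ let $T_A\subseteq O$ be an arbitrarily chosen nonempty set of test vectors. Then total negativity and total non-positivity cannot be characterized by the variation diminishing property or by the sign non-reversal property using these test vectors. Precisely, each of the following four assertions is false: (a) For every $A\in\mathbb{R}^{r\times r}$ with $A<0$ that is totally negative of order $r-1$: $A$ is totally negative if and only if $A$ has the variation diminishing property (negative version) on $T_A$. (b) For every $A\in\mathbb{R}^{r\times r}$ with $A<0$ that is totally negative of order $r-1$: $A$ is totally negative if and only if $A$ has the sign non-reversal property on $T_A$. (c) For every $A\in\mathbb{R}^{r\times r}$ with $A\leq0$ that is totally non-positive of order $r-1$: $A$ is totally non-positive if and only if $A$ has the variation diminishing property (non-positive version) on $T_A$. (d) For every $A\in\mathbb{R}^{r\times r}$ with $A\leq0$ that is totally non-positive of order $r-1$: $A$ is totally non-positive if and only if $A$ has the non-strict sign non-reversal property on $T_A$.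
   Context: A real matrix is totally negative (totally non-positive) of order $k$ if all its minors of order at most $k$ are negative (non-positive); an $r\times r$ matrix is totally negative (totally non-positive) if this holds with $k=r$. $A<0$ (resp. $A\le0$) means all entries are negative (resp. non-positive). An open orthant of $\mathbb{R}^r$ is a set $\{x: \epsilon_ix_i>0 \text{ for all } i\}$ for some $\epsilon\in\{\pm1\}^r$. $\mathbb{R}^r_{\mathrm{alt}}$ is the set of vectors in $\mathbb{R}^r$ whose coordinates are all nonzero and have alternating signs (the union of two open orthants). For a vector $x$, $S^-(x)$ is the number of sign changes in $x$ after removing zero entries, and $S^+(x)$ is the maximum number of sign changes obtained after assigning $\pm1$ to each zero entry; $S^+(0):=r$ and $S^-(0):=0$ for $0\in\mathbb{R}^r$. Properties of $A$ on a set $T$: - Variation diminishing property (negative version): for all $x\in T$, $S^+(Ax)\leq S^-(x)$, and if equality holds and $Ax\neq0$ then the first (last) component of $Ax$ (if zero, the unique sign given to it in determining $S^+(Ax)$) has the same sign as the first (last) nonzero component of $x$. - Variation diminishing property (non-positive version): for all $x\in T$, $S^-(Ax)\leq S^-(x)$, and if equality holds and $Ax\neq0$ then the first (last) nonzero component of $Ax$ has the same sign as the first (last) nonzero component of $x$. - Sign non-reversal property: for every $0\neq x\in T$ there is $i$ with $x_i(Ax)_i>0$. - Non-strict sign non-reversal property: for every $0\neq x\in T$ there is $i$ with $x_i\neq0$ and $x_i(Ax)_i\geq0$. *)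

(* Defs.v *)
From HB Require Import structures.
From mathcomp Require Import all_boot all_order all_algebra.
From mathcomp Require Import classical_sets reals.

Set Implicit Arguments.
Unset Strict Implicit.
Unset Printing Implicit Defensive.

Import Order.TTheory GRing.Theory Num.Theory.

Local Open Scope classical_set_scope.
Local Open Scope ring_scope.

Section Defs.
Variable R : realType.

(* The empty minor (equal to 1) is excluded by [0 < p]. *)
Definition totally_negative_of_order m n (k : nat) (A : 'M[R]_(m, n)) : Prop :=
  forall (p : nat) (f : 'I_p -> 'I_m) (g : 'I_p -> 'I_n),
    (0 < p <= k)%N ->
    {homo f : i j / (i < j)%N} -> {homo g : i j / (i < j)%N} ->
    \det (mxsub f g A) < 0.

Definition totally_nonpositive_of_order m n (k : nat) (A : 'M[R]_(m, n)) : Prop :=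
  forall (p : nat) (f : 'I_p -> 'I_m) (g : 'I_p -> 'I_n),
    (0 < p <= k)%N ->
    {homo f : i j / (i < j)%N} -> {homo g : i j / (i < j)%N} ->
    \det (mxsub f g A) <= 0.

Definition totally_negative r (A : 'M[R]_r) : Prop :=
  totally_negative_of_order r A.

Definition totally_nonpositive r (A : 'M[R]_r) : Prop :=
  totally_nonpositive_of_order r A.

Definition open_orthant r (eps : 'I_r -> bool) : set 'cV[R]_r :=
  [set x | forall i, 0 < (-1) ^+ eps i * x i 0].

Definition alternating r : set 'cV[R]_r :=
  [set x | (forall i, x i 0 != 0) /\
           (forall i j : 'I_r, j = i.+1 :> nat -> x i 0 * x j 0 < 0)].

Definition entries r (x : 'cV[R]_r) : seq R := [seq x i 0 | i <- enum 'I_r].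

Definition nonzero_entries r (x : 'cV[R]_r) : seq R :=
  [seq a <- entries x | a != 0].

(* Meaningful for sequences without zeros. *)
Definition sign_changes (s : seq R) : nat :=
  count (fun ab => ab.1 * ab.2 < 0) (zip s (behead s)).

Definition assign_signs r (e : {ffun 'I_r -> bool}) (x : 'cV[R]_r) : 'cV[R]_r :=
  \col_i (if x i 0 == 0 then (-1) ^+ e i else x i 0).

Definition Sminus r (x : 'cV[R]_r) : nat := sign_changes (nonzero_entries x).

Definition Splus r (x : 'cV[R]_r) : nat :=
  if x == 0 then r
  else \max_(e : {ffun 'I_r -> bool}) sign_changes (entries (assign_signs e x)).

(* If A *m x is nonzero, all the sign assignments e attaining Splus (A *m x)
   give the same signs to the zeros preceding the first nonzero component and to
   those following the last one, so quantifying over such e amounts to speaking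
   of the sign that e gives to the first (last) component. *)
Definition variation_diminishing_neg r (A : 'M[R]_r) (T : set 'cV[R]_r) : Prop :=
  forall x, T x ->
    (Splus (A *m x) <= Sminus x)%N /\
    (Splus (A *m x) = Sminus x -> A *m x <> 0 ->
     forall e : {ffun 'I_r -> bool},
       let s := entries (assign_signs e (A *m x)) in
       sign_changes s = Splus (A *m x) ->
       0 < head 0 s * head 0 (nonzero_entries x) /\
       0 < last 0 s * last 0 (nonzero_entries x)).

Definition variation_diminishing_nonpos r (A : 'M[R]_r) (T : set 'cV[R]_r) : Prop :=
  forall x, T x ->
    (Sminus (A *m x) <= Sminus x)%N /\
    (Sminus (A *m x) = Sminus x -> A *m x <> 0 ->
     0 < head 0 (nonzero_entries (A *m x)) * head 0 (nonzero_entries x) /\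
     0 < last 0 (nonzero_entries (A *m x)) * last 0 (nonzero_entries x)).

Definition sign_non_reversal r (A : 'M[R]_r) (T : set 'cV[R]_r) : Prop :=
  forall x, T x -> x <> 0 -> exists i, 0 < x i 0 * (A *m x) i 0.

Definition nonstrict_sign_non_reversal r (A : 'M[R]_r) (T : set 'cV[R]_r) : Prop :=
  forall x, T x -> x <> 0 ->
    exists i, x i 0 != 0 /\ 0 <= x i 0 * (A *m x) i 0.

End Defs.

Arguments alternating : clear implicits.

(* Main.v *)
Require Import Defs.
From HB Require Import structures.
From mathcomp Require Import all_boot all_order all_algebra.
From mathcomp Require Import classical_sets reals.
From mathcomp Require Import zify.

Set Implicit Arguments.
Unset Strict Implicit.
Unset Printing Implicit Defensive.

Import Order.TTheory GRing.Theory Num.Theory.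

Local Open Scope classical_set_scope.
Local Open Scope ring_scope.

(** Why the four equivalences fail.  All vectors of an open orthant [O] have the
same sign pattern, so two cases arise.

If the pattern is constant and [A] has negative entries, then for [x] in [O]
every coordinate of [A x] has the sign opposite to that of [x]: all four
properties fail at [x].  Any totally negative matrix then breaks the equivalences
([one_sign_no_variation], [one_sign_reversal]).

Otherwise the pattern of [x] has [p] sign changes with [1 <= p <= r - 2], because
an orthant outside the alternating vectors has some pair of neighbouring
coordinates of equal sign.  The usual proof that a totally negative matrix
diminishes variation uses only minors of order at most [p + 1] here: grouping
the columns of [A] along the constant-sign blocks of [x] gives a matrix [Z] with
[p + 1] columns and negative minors such that [A x = Z c], where [c] alternates.
Cramer's rule on [p + 1] rows of [Z] on which [A x] weakly alternates in sign
then forces the first of these signs to be that of [x]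
([totally_negative_alternating_rows]).  From [p + 2] alternating rows one could
drop either the first or the last, which would yield both signs, so [A x] has at
most [p] sign changes ([variation_bound]).  Hence all four properties hold on
[O] for every matrix that is totally negative of order [r - 1], including one
with positive determinant ([exists_almost_totally_negative]).

It remains to exhibit the two matrices.  Let [D] be a totally positive matrix and
[B] the matrix of its cumulative sums over [a < i, b < j].  Differencing
consecutive rows and columns shows that every minor of [c J + B], with [J] the
all-ones matrix, is affine in [c] with a positive slope that is a sum of minors
of [D] ([det_cumulative]).  With [c = 1] this produces totally positive matrices
by induction on the size, and with [c] very negative a totally negative matrix
[N].  Discarding the last column of [N], and then taking the first remaining
column, the sums of neighbouring columns and the last one, makes the matrix
singular while its smaller minors stay negative ([totally_negative_spread]); a
small decrease of the top left entry then makes the determinant positive. *)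

(** * Minors of products with staircase matrices *)

Definition increasing p n (f : 'I_p -> 'I_n) : Prop := {homo f : i j / (i < j)%N}.

Lemma increasing_comp p m n (f : 'I_m -> 'I_n) (g : 'I_p -> 'I_m) :
  increasing f -> increasing g -> increasing (fun i => f (g i)).
Proof. by move=> hf hg i j /hg /hf. Qed.

Lemma increasing_lift n (h : 'I_n.+1) : increasing (lift h : 'I_n -> 'I_n.+1).
Proof. by move=> i j ij; rewrite /= !/bump; lia. Qed.

(** Multilinearity in the columns of the product.  The sum runs over all maps [a]:
for the matrices [C] used below the non-injective ones and the increasing ones
are the only ones that matter, so the summands need no regrouping by image. *)
Lemma det_mulmx_expand (R : comNzRingType) n k (M : 'M[R]_(k, n)) (C : 'M_(n, k)) :
  \det (M *m C) =
  \sum_(a : {ffun 'I_k -> 'I_n}) (\prod_i C (a i) i) * \det (colsub a M).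
Proof.
rewrite -det_tr; under [RHS]eq_bigr => a _ do rewrite -det_tr mulr_sumr.
rewrite [RHS]exchange_big; apply: eq_bigr => s _ /=.
under eq_bigr => i _ do rewrite mxE mxE.
rewrite bigA_distr_bigA mulr_sumr; apply: eq_bigr => a _ /=.
rewrite big_split /= mulrA mulrC; congr (_ * (_ * _)).
by apply: eq_bigr => i _; rewrite !mxE.
Qed.

(** The supports of the columns of [C] move downwards, two consecutive ones
sharing at most one row.  Then a choice of one row in the support of each column
is weakly increasing. *)
Definition staircase (R : numDomainType) n k (C : 'M[R]_(n, k)) : Prop :=
  (forall a i, 0 <= C a i) /\
  (forall a b (i j : 'I_k), (i < j)%N -> C a i != 0 -> C b j != 0 -> (a <= b)%N).

Lemma staircase_colsub (R : numDomainType) n k p (C : 'M[R]_(n, k))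
    (h : 'I_p -> 'I_k) :
  increasing h -> staircase C -> staircase (colsub h C).
Proof.
move=> hh [C0 CS]; split=> [a i|a b i j ij]; first by rewrite mxE.
by rewrite !mxE; apply: CS; apply: hh.
Qed.

(** Either the product of coefficients vanishes, or [a] is weakly increasing; in
the latter case a repeated value gives two equal columns, and otherwise the
determinant is a minor with increasing indices. *)
Lemma staircase_term (R : numDomainType) n k (M : 'M[R]_(k, n)) (C : 'M[R]_(n, k))
    (s : R) (a : 'I_k -> 'I_n) :
  staircase C ->
  (forall b, increasing b -> 0 <= s * \det (colsub b M)) ->
  0 <= s * ((\prod_i C (a i) i) * \det (colsub a M)).
Proof.
move=> [C0 CS] H.
have [p0|pN0] := eqVneq (\prod_i C (a i) i) 0; first by rewrite p0 mul0r mulr0.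
have CN0 i : C (a i) i != 0 by move/prodf_neq0: pN0; apply.
case: (pickP (fun ij : 'I_k * 'I_k => (ij.1 != ij.2) && (a ij.1 == a ij.2))).
  move=> [i j] /= /andP[ij /eqP aij].
  rewrite -det_tr (determinant_alternate ij) ?mulr0 // => l.
  by rewrite !mxE aij.
move=> aI; rewrite mulrCA mulr_ge0 ?prodr_ge0 //; apply: H => i j ij.
have := CS _ _ _ _ ij (CN0 i) (CN0 j); have := aI (i, j) => /=.
rewrite -val_eqE /= => /negbT; rewrite negb_and -!val_eqE /=; lia.
Qed.

Lemma det_mul_staircase_ge0 (R : numDomainType) n k (M : 'M[R]_(k, n))
    (C : 'M[R]_(n, k)) (s : R) :
  staircase C ->
  (forall b, increasing b -> 0 <= s * \det (colsub b M)) ->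
  0 <= s * \det (M *m C).
Proof.
move=> CS H; rewrite det_mulmx_expand mulr_sumr sumr_ge0 // => a _.
exact: staircase_term.
Qed.

(** The factor [s] is a sign: it lets the same statement serve positive and
negative minors.  The map [a] exhibits one nonzero term. *)
Lemma det_mul_staircase_gt0 (R : numDomainType) n k (M : 'M[R]_(k, n))
    (C : 'M[R]_(n, k)) (s : R) (a : 'I_k -> 'I_n) :
  staircase C ->
  (forall b, increasing b -> 0 < s * \det (colsub b M)) ->
  increasing a -> (forall i, C (a i) i != 0) ->
  0 < s * \det (M *m C).
Proof.
move=> CS H ha aN0; rewrite det_mulmx_expand mulr_sumr (bigD1 (finfun a)) //=.
apply: ltr_wpDr.
  by apply: sumr_ge0 => b _; apply: staircase_term => // c /H/ltW.
have -> : colsub (finfun a) M = colsub a M.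
  by apply/matrixP=> i j; rewrite !mxE ffunE.
rewrite mulrCA mulr_gt0 ?H // prodr_gt0 // => i _; rewrite ffunE lt0r aN0.
by case: CS => ->.
Qed.

Lemma det_add_corner (R : comNzRingType) k (M : 'M[R]_k.+1) (c : R) :
  \det (M + c *: delta_mx 0 0) = \det M + c * \det (row' 0 (col' 0 M)).
Proof.
rewrite (expand_det_row _ 0) (expand_det_row M 0).
rewrite (bigD1 ord0) // [in RHS](bigD1 ord0) //=.
have cofE j : cofactor (M + c *: delta_mx 0 0) 0 j = cofactor M 0 j.
  rewrite /cofactor; congr (_ * \det _).
  by apply/matrixP => i l; rewrite !mxE /= mulr0 addr0.
rewrite cofE !mxE !eqxx mulr1 mulrDl -!addrA; congr (_ + _); rewrite addrC.
congr (_ + _); last by rewrite /cofactor addn0 expr0 mul1r.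
by apply: eq_bigr => j jN0; rewrite cofE !mxE (negbTE jN0) andbF mulr0 addr0.
Qed.

(** * Totally positive and totally negative matrices *)

Definition totally_positive (R : numDomainType) n (D : 'M[R]_n) : Prop :=
  forall p (f g : 'I_p -> 'I_n), increasing f -> increasing g ->
    0 < \det (mxsub f g D).

Definition prefix_mx (R : numDomainType) n : 'M[R]_(n, n.+1) :=
  \matrix_(a, i) (a < i)%:R.

(** The entry at [(i, j)] is [c] plus the sum of the entries of [D] at the
positions [(a, b)] with [a < i] and [b < j]. *)
Definition cumulative (R : numDomainType) n (c : R) (D : 'M[R]_n) : 'M[R]_n.+1 :=
  const_mx c + (prefix_mx R n)^T *m D *m prefix_mx R n.

(** Column [i] is the indicator of the interval from [f (i - 1)] (or [0]) to
[f i - 1]: it is the difference of columns [f i] and [f (i - 1)] of the prefix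
matrix. *)
Definition gap_mx (R : numDomainType) n k (f : 'I_k.+1 -> 'I_n.+1) : 'M[R]_(n, k.+1) :=
  \matrix_(a, i) ((a < f i) && [forall j : 'I_k.+1, (j < i) ==> (f j <= a)])%N%:R.

Lemma gap_mx_neq0 (R : numDomainType) n k (f : 'I_k.+1 -> 'I_n.+1)
    (a : 'I_n) i :
  reflect ((a < f i)%N /\ forall j : 'I_k.+1, (j < i)%N -> (f j <= a)%N)
    (gap_mx R f a i != 0).
Proof.
rewrite mxE pnatr_eq0 eqb0 negbK.
apply: (iffP andP) => -[afi H]; split=> //.
  by move=> j ji; have /forallP/(_ j)/implyP := H; apply.
by apply/forallP => j; apply/implyP/H.
Qed.

Lemma staircase_gap_mx (R : numDomainType) n k (f : 'I_k.+1 -> 'I_n.+1) :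
  staircase (gap_mx R f).
Proof.
split=> [a i|a b i j ij]; first by rewrite mxE.
by move=> /gap_mx_neq0[afi _] /gap_mx_neq0[_ /(_ _ ij)]; lia.
Qed.

Definition ones_triangle (R : numDomainType) k : 'M[R]_k :=
  \matrix_(i, j) (i <= j)%N%:R.

Lemma det_ones_triangle (R : numDomainType) k : \det (ones_triangle R k) = 1.
Proof.
rewrite -det_tr det_trig; first by apply: big1 => i _; rewrite !mxE leqnn.
by apply/is_trig_mxP => i j ij; rewrite !mxE leqNgt ij.
Qed.

(** Summation by parts: an initial interval is the disjoint union of the gaps that
it contains. *)
Lemma gap_mx_prefix (R : numDomainType) n k (f : 'I_k.+1 -> 'I_n.+1) :
  increasing f ->
  colsub f (prefix_mx R n) = gap_mx R f *m ones_triangle R k.+1.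
Proof.
move=> hf; have hfw (i j : 'I_k.+1) : (i <= j)%N -> (f i <= f j)%N.
  by rewrite leq_eqVlt => /orP[/eqP/val_inj->//|/hf/ltnW].
apply/matrixP => a j; rewrite !mxE.
have [afj|fja] := ltnP.
  (* The only gap containing [a] is that of the least [i0] with [a < f i0]. *)
  have [i0 afi0 i0min] := @arg_minnP _ j (fun i => (a < f i)%N) id afj.
  have gi0 : gap_mx R f a i0 = 1.
    rewrite mxE afi0 /=; case: forallP => // -[] i; apply/implyP => ii0.
    by rewrite leqNgt; apply/negP => /i0min; rewrite leqNgt ii0.
  rewrite (bigD1 i0) //= gi0 mxE i0min // mul1r big1 ?addr0 // => i ii0.
  apply/eqP; rewrite mulf_eq0; apply/orP; left.
  apply/negPn/negP => /gap_mx_neq0[afi H]; have := i0min i afi.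
  rewrite leq_eqVlt => /orP[/eqP/val_inj e|/H]; first by rewrite e eqxx in ii0.
  by rewrite leqNgt afi0.
rewrite big1 // => i _; rewrite !mxE; case: (leqP i j) => [/hfw|]; last by rewrite mulr0.
by move=> fij; rewrite ltnNge (leq_trans fij fja) mul0r.
Qed.

(** Sums of [D] over the rectangles cut out by consecutive values of [f] and [g]. *)
Definition gap_block (R : numDomainType) n k (f g : 'I_k.+1 -> 'I_n.+1) (D : 'M[R]_n) :=
  (gap_mx R f)^T *m D *m gap_mx R g.

(** Both index sets are differenced at once, which has determinant one.  The
all-ones matrix becomes the single corner entry, so [c] enters linearly. *)
Lemma det_cumulative (R : numDomainType) n k (f g : 'I_k.+1 -> 'I_n.+1) c
    (D : 'M[R]_n) :
  increasing f -> increasing g ->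
  \det (mxsub f g (cumulative c D)) =
  \det (gap_block f g D) + c * \det (row' 0 (col' 0 (gap_block f g D))).
Proof.
move=> hf hg; rewrite -det_add_corner.
suff -> : mxsub f g (cumulative c D) =
    (ones_triangle R k.+1)^T *m (gap_block f g D + c *: delta_mx 0 0)
      *m ones_triangle R k.+1.
  by rewrite !det_mulmx det_tr det_ones_triangle mul1r mulr1.
rewrite mulmxDr mulmxDl /cumulative.
have -> : mxsub f g (const_mx c + (prefix_mx R n)^T *m D *m prefix_mx R n) =
   const_mx c + (colsub f (prefix_mx R n))^T *m D *m colsub g (prefix_mx R n).
  have -> : (colsub f (prefix_mx R n))^T = rowsub f (prefix_mx R n)^T.
    by apply/matrixP => i j; rewrite !mxE.
  rewrite mul_rowsub_mx -mxsub_mul.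
  by apply/matrixP => i j; rewrite !mxE.
rewrite !gap_mx_prefix // trmx_mul !mulmxA addrC; congr (_ + _).
rewrite -scalemxAr -scalemxAl; apply/matrixP => i j; rewrite !mxE.
rewrite (bigD1 ord0) //= big1 ?addr0 => [|l lN0]; last first.
  rewrite mxE big1 ?mul0r // => m _; rewrite !mxE (negbTE lN0) andbF mulr0 //.
rewrite mxE (bigD1 ord0) //= big1 ?addr0 => [|l lN0]; last first.
  by rewrite !mxE (negbTE lN0) /= mulr0.
by rewrite !mxE !eqxx !mulr1.
Qed.

Lemma det_gap_block_ge0 (R : numDomainType) n k (f g : 'I_k.+1 -> 'I_n.+1)
    (D : 'M[R]_n) :
  totally_positive D -> 0 <= \det (gap_block f g D).
Proof.
move=> DP; rewrite -[\det _]mul1r.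
apply: det_mul_staircase_ge0 => [|b hb]; first exact: staircase_gap_mx.
rewrite -mulmx_colsub -det_tr trmx_mul trmxK.
apply: det_mul_staircase_ge0 => [|a ha]; first exact: staircase_gap_mx.
rewrite mul1r.
have -> : colsub a (colsub b D)^T = (mxsub a b D)^T.
  by apply/matrixP => i j; rewrite !mxE.
by rewrite det_tr ltW // DP.
Qed.

(** The gap before [f (i + 1)] contains [f (i + 1) - 1].  The gap before [f 0] is
empty when [f 0 = 0], which is why it is left out. *)
Lemma gap_witness (R : numDomainType) n k (f : 'I_k.+1 -> 'I_n.+1) :
  increasing f ->
  exists2 a : 'I_k -> 'I_n, increasing a &
    forall i, gap_mx R f (a i) (lift ord0 i) != 0.
Proof.
move=> hf.
have fgt (i : 'I_k) : (0 < f (lift ord0 i))%N.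
  by apply: leq_ltn_trans (hf ord0 (lift ord0 i) _).
have aP (i : 'I_k) : ((f (lift ord0 i)).-1 < n)%N.
  by have := ltn_ord (f (lift ord0 i)); have := fgt i; lia.
exists (fun i => Ordinal (aP i)).
  move=> i j ij /=; have := fgt i; have := fgt j.
  have := hf (lift ord0 i) (lift ord0 j) (increasing_lift ord0 ij); lia.
move=> i; apply/gap_mx_neq0; split=> [|j /(hf j)] /=; have := fgt i; lia.
Qed.

Lemma det_gap_block_minor_gt0 (R : numDomainType) n k (f g : 'I_k.+1 -> 'I_n.+1)
    (D : 'M[R]_n) :
  totally_positive D -> increasing f -> increasing g ->
  0 < \det (row' 0 (col' 0 (gap_block f g D))).
Proof.
move=> DP hf hg; rewrite -[\det _]mul1r.
have -> : row' 0 (col' 0 (gap_block f g D)) =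
    (col' 0 (gap_mx R f))^T *m D *m col' 0 (gap_mx R g).
  rewrite col'Esub row'Esub -mulmx_colsub -!mul_rowsub_mx.
  by congr (_ *m _ *m _); rewrite !col'Esub; apply/matrixP => i j; rewrite !mxE.
have [a ha aP] := gap_witness R hf; have [b hb bP] := gap_witness R hg.
have SC h : staircase (col' 0 (gap_mx R h) : 'M_(n, k)).
  rewrite col'Esub; apply: staircase_colsub (@increasing_lift _ _) _.
  exact: staircase_gap_mx.
apply: (det_mul_staircase_gt0 (a := b)) => // [c hc|i]; last by rewrite mxE; apply: bP.
rewrite -mulmx_colsub -det_tr trmx_mul trmxK.
apply: (det_mul_staircase_gt0 (a := a)) => // [d hd|i]; last by rewrite mxE; apply: aP.
rewrite mul1r.
have -> : colsub d (colsub c D)^T = (mxsub d c D)^T.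
  by apply/matrixP => i j; rewrite !mxE.
by rewrite det_tr DP.
Qed.

(** Starting from the empty matrix, this builds Pascal's symmetric matrices. *)
Lemma exists_totally_positive (R : numDomainType) n :
  exists D : 'M[R]_n, totally_positive D.
Proof.
elim: n => [|n [D DP]].
  exists 0 => -[|p] f g _ _; first by rewrite det_mx00.
  by case: (f ord0).
exists (cumulative 1 D) => -[|p] f g hf hg; first by rewrite det_mx00.
rewrite det_cumulative // mul1r ltr_wpDl ?det_gap_block_ge0 //.
exact: det_gap_block_minor_gt0.
Qed.

(** Finitely many affine functions with positive slope are dominated at once. *)
Lemma exists_dominating (R : realFieldType) (I : finType) (a b : I -> R) :
  exists2 x : R, 0 < x & forall i, 0 < b i -> a i < x * b i.
Proof.
exists (1 + \sum_i `|a i / b i|).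
  by rewrite ltr_pwDl ?ltr01 ?sumr_ge0.
move=> i bi; rewrite -ltr_pdivrMr // (bigD1 i) //= addrCA.
by rewrite (le_lt_trans (ler_norm _)) // ltrDl ltr_pwDl ?sumr_ge0.
Qed.

Lemma exists_totally_negative (R : realType) n :
  exists N : 'M[R]_n.+1, totally_negative N.
Proof.
have [D DP] := exists_totally_positive R n.
(* All pairs of index maps form a finite type, on which [x] is uniform. *)
pose J := {k : 'I_n.+1 & ({ffun 'I_k.+1 -> 'I_n.+1} * {ffun 'I_k.+1 -> 'I_n.+1})%type}.
pose K (u : J) := gap_block (tagged u).1 (tagged u).2 D.
have [x x0 xP] := @exists_dominating R J (fun u => \det (K u))
  (fun u => \det (row' 0 (col' 0 (K u)))).
exists (cumulative (- x) D) => -[//|k] f g /andP[_ kn] hf hg.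
have -> : mxsub f g (cumulative (- x) D) = mxsub (finfun f) (finfun g) (cumulative (- x) D).
  by apply/matrixP => i j; rewrite !mxE !ffunE.
have hF h : @increasing k.+1 n.+1 h -> increasing (finfun h).
  by move=> hh i j ij; rewrite !ffunE; apply: hh.
rewrite det_cumulative ?mulNr ?subr_lt0; try exact: hF.
apply: (xP (existT _ (Ordinal kn) (finfun f, finfun g) : J)).
by apply: det_gap_block_minor_gt0 => //; exact: hF.
Qed.

(** * A totally negative matrix of submaximal order with positive determinant *)

(** Bidiagonal, with a zero last row: column [j] of [N *m spread_mx R n] is the sum
of columns [j - 1] and [j] of [N], the last column of [N] being discarded. *)
Definition spread_mx (R : numDomainType) n : 'M[R]_n.+1 :=
  \matrix_(h, j) ((h < n) && ((h == j :> nat) || (h.+1 == j)))%N%:R.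

Lemma staircase_spread_mx (R : numDomainType) n : staircase (spread_mx R n).
Proof.
split=> [a i|a b i j ij]; first by rewrite mxE.
by rewrite !mxE !pnatr_eq0 !eqb0 !negbK => /andP[_ H1] /andP[_ H2]; lia.
Qed.

Lemma det_spread_mx (R : numDomainType) n : \det (spread_mx R n) = 0.
Proof.
rewrite (expand_det_row _ ord_max) big1 // => j _.
by rewrite mxE /= ltnn mul0r.
Qed.

(** A minor of the product is a sum of minors of [N].  One of them occurs because
at most [n] of the [n + 1] columns are selected: if column [c] is not, each
selected column before [c] keeps its index and each one after [c] is shifted
back by one, so that the discarded column is never used. *)
Lemma totally_negative_spread (R : realType) n (N : 'M[R]_n.+1) :
  totally_negative N -> totally_negative_of_order n (N *m spread_mx R n).
Proof.
move=> NN p f g /andP[p0 pn] hf hg.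
rewrite mxsub_mul -oppr_gt0 -mulN1r.
have [c cP] : exists c : 'I_n.+1, forall i, g i != c.
  case: (pickP [pred c | c \notin codom g]) => [c /= cg|H].
    by exists c => i; apply: contraNneq cg => <-; apply: codom_f.
  have := card_size (codom g); rewrite size_codom card_ord.
  rewrite (@eq_card _ _ 'I_n.+1) ?card_ord; first by rewrite ltnNge pn.
  by move=> c; have /negbFE := H c.
pose h i : 'I_n.+1 := inord (g i - (c < g i)%N).
have hE i : h i = (g i - (c < g i)%N)%N :> nat.
  by rewrite inordK //; have := ltn_ord (g i); lia.
have gc i : (g i != c :> nat)%N by apply: cP.
apply: (det_mul_staircase_gt0 (a := h)).
- by apply: staircase_colsub => //; apply: staircase_spread_mx.
- move=> b hb; rewrite mulN1r oppr_gt0.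
  have -> : colsub b (rowsub f N) = mxsub f b N by apply/matrixP => i j; rewrite !mxE.
  by apply: NN => //; rewrite p0 ltnW.
- by move=> i j ij; rewrite !hE; have := hg _ _ ij; have := gc i; have := gc j; lia.
- move=> i; rewrite !mxE hE pnatr_eq0 eqb0 negbK.
  by have := ltn_ord (g i); have := ltn_ord c; have := gc i; lia.
Qed.

(** The matrix [A] below is singular with negative minors of smaller order.
Subtracting [1 / x] from its top left entry adds to the determinant [- 1 / x]
times a negative minor, while the smaller minors stay negative for [x] large. *)
Lemma exists_almost_totally_negative (R : realType) n :
  exists A : 'M[R]_n.+2, totally_negative_of_order n.+1 A /\ 0 < \det A.
Proof.
have [N NN] := exists_totally_negative R n.+1.
set A := N *m spread_mx R n.+1.
have AN : totally_negative_of_order n.+1 A by apply: totally_negative_spread.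
have detA : \det A = 0 by rewrite det_mulmx det_spread_mx mulr0.
pose J := {k : 'I_n.+1 & ({ffun 'I_k.+1 -> 'I_n.+2} * {ffun 'I_k.+1 -> 'I_n.+2})%type}.
pose K (u : J) := mxsub (tagged u).1 (tagged u).2 A.
have [x x0 xP] := @exists_dominating R J
  (fun u => - \det (row' 0 (col' 0 (K u)))) (fun u => - \det (K u)).
(* An increasing index map takes the value [0] at [0] only, so the perturbation
   of a minor sits in its own corner, if anywhere. *)
have subE k (f g : 'I_k.+1 -> 'I_n.+2) : increasing f -> increasing g ->
    mxsub f g (A + (- x^-1) *: delta_mx 0 0) =
    mxsub f g A + (- x^-1 *+ ((f 0 == 0) && (g 0 == 0))) *: delta_mx 0 0.
  move=> hf hg; apply/matrixP => i j; rewrite !mxE; congr (_ + _).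
  have fE h (l : 'I_k.+1) : @increasing _ n.+2 h -> (h l == 0) = (l == 0) && (h 0 == 0).
    move=> hh; case: (eqVneq l 0) => [->//|lN0] /=.
    have := hh ord0 l; rewrite lt0n => /(_ lN0).
    by rewrite -val_eqE /=; lia.
  rewrite (fE f) // (fE g) //.
  by do 4 case: eqP => _; rewrite /= ?mulr1 ?mulr0 ?mul0r.
exists (A + (- x^-1) *: delta_mx 0 0); split; last first.
  rewrite det_add_corner detA add0r mulNr oppr_gt0 nmulr_llt0 ?invr_gt0 //.
  have -> : row' 0 (col' 0 A) = mxsub (lift ord0) (lift ord0) A :> 'M_n.+1.
    by apply/matrixP => i j; rewrite !mxE.
  by apply: AN; rewrite /= ?leqnn //; apply: (@increasing_lift n.+1 ord0).
move=> [//|k] f g /andP[_ kn] hf hg.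
have AfgN : \det (mxsub f g A) < 0 by apply: AN.
rewrite subE // det_add_corner.
have [_|_] := boolP (_ && _); last by rewrite mulr0n mul0r addr0.
rewrite mulr1n mulNr subr_lt0 mulrC ltr_pdivlMr //.
pose u : J := existT _ (Ordinal kn) (finfun f, finfun g).
have KE : K u = mxsub f g A.
  by apply/matrixP => i j; rewrite !mxE !ffunE.
by have := xP u; rewrite KE oppr_gt0 mulrN ltrN2 mulrC; apply.
Qed.

(** * Sign changes of sequences *)

(** Having the same strict sign is transitive. *)
Lemma mulr_gt0_trans (R : realDomainType) (b a c : R) :
  0 < a * b -> 0 < b * c -> 0 < a * c.
Proof.
move=> ab bc; have bN0 : b != 0.
  by apply: contraTneq ab => ->; rewrite mulr0 ltxx.
have b2 : 0 < b ^+ 2 by rewrite exprn_even_gt0.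
by rewrite -(pmulr_lgt0 _ b2) expr2 mulrACA [c * b]mulrC mulr_gt0.
Qed.

Lemma mulr_ge0_trans (R : realDomainType) (b a c : R) :
  0 < a * b -> 0 <= b * c -> 0 <= a * c.
Proof.
move=> ab; rewrite le0r => /orP[|bc]; last exact/ltW/(mulr_gt0_trans ab).
rewrite mulf_eq0 => /orP[] /eqP h; last by rewrite h mulr0.
by rewrite h mulr0 ltxx in ab.
Qed.

(** Sign changes among the first [m + 1] terms.  As a function of [m] it labels the
blocks of constant sign of [u] by consecutive integers from [0]. *)
Definition flips (R : numDomainType) (u : nat -> R) m : nat :=
  (\sum_(0 <= i < m) (u i * u i.+1 < 0)%R)%N.

Lemma flipsS (R : numDomainType) (u : nat -> R) m :
  flips u m.+1 = (flips u m + (u m * u m.+1 < 0)%R)%N.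
Proof. by rewrite /flips big_nat_recr. Qed.

Lemma leq_flips (R : numDomainType) (u : nat -> R) i j :
  (i <= j)%N -> (flips u i <= flips u j)%N.
Proof. by move=> ij; rewrite /flips [leqRHS](big_cat_nat (leq0n i) ij) leq_addr. Qed.

Lemma flips_sign (R : realDomainType) (u : nat -> R) m :
  (forall i, (i <= m)%N -> u i != 0) -> 0 < (-1) ^+ flips u m * u 0%N * u m.
Proof.
elim: m => [|m IH] uN0.
  by rewrite /flips big_nil expr0 mul1r -expr2 exprn_even_gt0 ?uN0.
have {}IH := IH (fun i im => uN0 i (leqW im)).
rewrite flipsS; case: (ltP (u m * u m.+1)) => /= h.
  rewrite addn1 exprS mulN1r !mulNr -mulrN.
  by apply: mulr_gt0_trans IH _; rewrite mulrN oppr_gt0.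
rewrite addn0; apply: mulr_gt0_trans IH _.
by rewrite lt_neqAle h eq_sym mulf_neq0 ?uN0.
Qed.

Lemma flips_leq (R : numDomainType) (u : nat -> R) m : (flips u m <= m)%N.
Proof.
elim: m => [|m IH]; first by rewrite /flips big_nil.
by rewrite flipsS -addn1 leq_add // leq_b1.
Qed.

Lemma flips_full (R : numDomainType) (u : nat -> R) m i :
  (m <= flips u m)%N -> (i < m)%N -> u i * u i.+1 < 0.
Proof.
elim: m => // m IH; rewrite flipsS; have := flips_leq u m.
case: (boolP (u m * u m.+1 < 0)) => [um|_] fm mf; last by exfalso; lia.
by rewrite ltnS leq_eqVlt => /orP[/eqP->//|]; apply: IH; lia.
Qed.

(** A discrete intermediate value theorem, as [flips u] increases by steps of at
most one: no block label is skipped. *)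
Lemma flips_ivt (R : numDomainType) (u : nat -> R) m h :
  (h <= flips u m)%N -> exists2 j, (j <= m)%N & flips u j = h.
Proof.
elim: m => [|m IH] hm.
  by exists 0%N => //; move: hm; rewrite /flips big_nil leqn0 => /eqP.
move: hm; rewrite leq_eqVlt => /orP[/eqP->|]; first by exists m.+1.
rewrite flipsS => hm; have [|j jm <-] := IH; last by exists j => //; apply: leqW.
by move: hm; case: (_ < _) => /=; lia.
Qed.

Lemma sign_changes_flips (R : realType) (s : seq R) :
  sign_changes s = flips (nth 0 s) (size s).-1.
Proof.
elim: s => [|a [|b s] IH]; rewrite /flips ?big_nil //.
have -> : sign_changes (a :: b :: s) = ((a * b < 0)%R + sign_changes (b :: s))%N by [].
rewrite IH /= big_nat_recl //=.
Qed.

Lemma sign_changes_sign (R : realType) (s : seq R) :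
  s != [::] -> all (fun a => a != 0) s ->
  0 < (-1) ^+ sign_changes s * head 0 s * last 0 s.
Proof.
move=> sN0 /all_nthP sP; rewrite sign_changes_flips -nth0 -nth_last.
by apply: flips_sign => i; case: s sN0 sP => // a s _ sP /= im; apply: sP.
Qed.

(** One representative from each block of constant sign.  The sign of the [k]-th
one is expressed relative to the head of the sequence. *)
Lemma exists_alternating_subseq (R : realType) (T : eqType) (v : T -> R) js :
  js != [::] -> all (fun j => v j != 0) js ->
  exists t, [/\ subseq t js, size t = (sign_changes (map v js)).+1 &
    forall j0 k, (k < size t)%N ->
      0 < (-1) ^+ k * head 0 (map v js) * v (nth j0 t k)].
Proof.
elim: js => // j js IH _ /= /andP[vj vjs].
case: js IH vjs => [_ _|j' js IH vjs].
  exists [:: j]; split=> [||j0 [|//] _] //=; first by rewrite eqxx.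
  by rewrite expr0 mul1r -expr2 exprn_even_gt0.
have [t [tjs st tP]] := IH isT vjs.
have -> : sign_changes (map v (j :: j' :: js)) =
  ((v j * v j' < 0)%R + sign_changes (map v (j' :: js)))%N by [].
have vj' : v j' != 0 by case/andP: vjs.
have [h|h] := ltP (v j * v j') 0.
  exists (j :: t); split=> /=; [by rewrite eqxx|by rewrite st|].
  move=> j0 [_|k] /=; first by rewrite expr0 mul1r -expr2 exprn_even_gt0.
  rewrite ltnS => kt; have := tP j0 k kt => /= {}tP.
  rewrite exprS mulN1r !mulNr mulrAC -mulrN mulrC.
  apply: (@mulr_gt0_trans _ (v j')); first by rewrite mulNr oppr_gt0.
  by rewrite mulrCA mulrA.
exists t; split=> [||j0 k kt]; first exact: subseq_trans tjs (subseq_cons _ _).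
  by rewrite st.
rewrite mulrAC mulrC; apply: (@mulr_gt0_trans _ (v j')).
  by rewrite lt_neqAle h eq_sym mulf_neq0.
by rewrite mulrCA mulrA; apply: tP.
Qed.

Lemma size_entries (R : realType) r (x : 'cV[R]_r) : size (entries x) = r.
Proof. by rewrite size_map size_enum_ord. Qed.

Lemma nth_entries (R : realType) r (x : 'cV[R]_r) (i : 'I_r) : (entries x)`_i = x i 0.
Proof. by rewrite (nth_map i) ?size_enum_ord // nth_ord_enum. Qed.

(** * Variation diminishing below the maximal order *)

Lemma sgr_of_sign (R : realDomainType) k (a b : R) :
  0 < (-1) ^+ k * a * b -> b = `|b| * ((-1) ^+ k * Num.sg a).
Proof.
move=> h; have : Num.sg ((-1) ^+ k * a * b) = 1 by rewrite gtr0_sg.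
rewrite !sgrM sgrX sgrN1 => e.
have aN0 : a != 0 by apply: contraTneq h => ->; rewrite mulr0 mul0r ltxx.
have -> : (-1) ^+ k * Num.sg a = Num.sg b.
  apply: (@mulIf _ (Num.sg b)).
    by rewrite sgr_eq0; apply: contraTneq h => ->; rewrite mulr0 ltxx.
  rewrite e -expr2 sqr_sg; case: eqVneq => // b0; by rewrite b0 mulr0 ltxx in h.
by rewrite mulrC -numEsg.
Qed.

(** With [W] the matrix of the blocks of [x], weighted by absolute values, and [c]
the vector of block signs, [x = W c].  Each minor of [A *m W] is a positive
combination of minors of [A].  Cramer's rule for the rows [I] writes
[c 0 * det] as an alternating sum of minors of order [p] weighted by
[(A x) (I k)], whose terms weakly have the sign of [- tau]; this is where both
[0 < p], so that these minors are nonempty and hence negative, and [p <= n] are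
used. *)
Lemma totally_negative_alternating_rows (R : realType) n (A : 'M[R]_n.+2)
    (x : 'cV[R]_n.+2) (I : 'I_(sign_changes (entries x)).+1 -> 'I_n.+2) (tau : R) :
  (forall i, x i 0 != 0) ->
  (0 < sign_changes (entries x) <= n)%N ->
  totally_negative_of_order n.+1 A ->
  increasing I -> tau != 0 ->
  (forall k : 'I__, 0 <= (-1) ^+ k * tau * (A *m x) (I k) 0) ->
  0 < tau * x 0 0.
Proof.
set p := sign_changes (entries x) in I * => xN0 /andP[p0 pn] AN hI tauN0 Itau.
pose u := nth 0 (entries x).
have uE (i : 'I_n.+2) : u i = x i 0 by rewrite /u nth_entries.
have uN0 i : (i < n.+2)%N -> u i != 0 by move=> im; rewrite (uE (Ordinal im)).
have pE : flips u n.+1 = p by rewrite /p sign_changes_flips size_entries.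
have bp (j : 'I_n.+2) : (flips u j < p.+1)%N by rewrite ltnS -pE leq_flips // -ltnS.
pose W : 'M[R]_(n.+2, p.+1) := \matrix_(j, b) (`|x j 0| *+ (flips u j == b)).
pose c : 'cV[R]_p.+1 := \col_b ((-1) ^+ b * Num.sg (x 0 0)).
have xE : x = W *m c.
  apply/matrixP => j l; rewrite ord1 mxE (bigD1 (Ordinal (bp j))) //= !mxE eqxx.
  rewrite big1 ?addr0 => [|b bN]; last first.
    rewrite !mxE; case: eqP => [e|_]; last by rewrite mul0r.
    by move: bN; rewrite -val_eqE /= e eqxx.
  apply: sgr_of_sign; rewrite -!uE; apply: flips_sign => i ij.
  by apply: uN0; apply: leq_ltn_trans ij (ltn_ord j).
have WS : staircase W.
  split=> [a i|a b i j ij]; first by rewrite mxE mulrn_wge0.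
  rewrite !mxE; case: (flips u a =P i) => [ei _|]; last by rewrite /= mulr0n eqxx.
  case: (flips u b =P j) => [ej _|]; last by rewrite /= mulr0n eqxx.
  rewrite leqNgt; apply/negP => ba; have := leq_flips u (ltnW ba); lia.
have AWN q (f : 'I_q -> 'I_n.+2) (h : 'I_q -> 'I_p.+1) : (0 < q <= n.+1)%N ->
    increasing f -> increasing h -> \det (mxsub f h (A *m W)) < 0.
  move=> qn hf hh; rewrite mxsub_mul -oppr_gt0 -mulN1r.
  have aex (b : 'I_p.+1) : exists j : 'I_n.+2, flips u j == b.
    have [|j jn jb] := @flips_ivt _ u n.+1 b; first by rewrite pE -ltnS.
    by exists (inord j); rewrite inordK // jb.
  pose a i := xchoose (aex (h i)).
  have aP i : flips u (a i) = h i by apply/eqP/(xchooseP (aex (h i))).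
  apply: (det_mul_staircase_gt0 (a := a)).
  - exact: staircase_colsub.
  - move=> b hb; rewrite mulN1r oppr_gt0.
    have -> : colsub b (rowsub f A) = mxsub f b A by apply/matrixP => i j; rewrite !mxE.
    exact: AN.
  - move=> i j ij; rewrite ltnNge; apply/negP => /(leq_flips u); rewrite !aP.
    by rewrite leqNgt hh.
  - by move=> i; rewrite !mxE aP eqxx mulr1n normr_eq0.
pose Z := rowsub I (A *m W).
have ZN : \det Z < 0 by apply: (AWN _ I id) => //; rewrite ltnS.
have Zc : Z *m c = rowsub I (A *m x).
  by rewrite /Z mul_rowsub_mx -mulmxA -xE.
(* First row of the adjugate applied to [Z c = (A x) restricted to I]. *)
have cramer : \det Z * Num.sg (x 0 0) = \sum_k (A *m x) (I k) 0 * cofactor Z k 0.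
  have := congr1 (fun M => (\adj Z *m M) 0 0) Zc.
  rewrite mulmxA mul_adj_mx mul_scalar_mx !mxE expr0 mul1r => ->.
  by apply: eq_bigr => k _; rewrite [(\adj Z) _ _]mxE [rowsub _ _ _ _]mxE mulrC.
have : \det Z * (tau * Num.sg (x 0 0)) <= 0.
  rewrite mulrCA cramer mulr_sumr sumr_le0 // => k _.
  rewrite /cofactor addn0 [_ * (_ ^+ _ * _)]mulrCA mulrCA !mulrA.
  apply: mulr_ge0_le0 => //; apply: ltW.
  have -> : row' k (col' 0 Z) = mxsub (I \o lift k) (lift 0) (A *m W).
    by apply/matrixP => i j; rewrite !mxE.
  apply: AWN; first by rewrite p0 /= leqW.
    exact: increasing_comp hI (@increasing_lift _ _).
  exact: increasing_lift.
rewrite nmulr_rle0 // => h.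
rewrite [x 0 0]numEsg mulrA pmulr_lgt0 ?normr_gt0 //.
by rewrite lt0r h mulf_neq0 // sgr_eq0.
Qed.

Definition ord_lt r : rel 'I_r := fun i j => (i < j)%N.

Lemma sorted_enum_ord r : sorted (@ord_lt _) (enum 'I_r).
Proof.
by have := iota_ltn_sorted 0 r; rewrite -val_enum_ord sorted_map.
Qed.

Lemma ord_lt_trans r : transitive (@ord_lt r).
Proof. by move=> j i k; apply: ltn_trans. Qed.

Lemma nonzero_entriesE (R : realType) r (x : 'cV[R]_r) :
  nonzero_entries x = [seq x i 0 | i <- enum 'I_r & x i 0 != 0].
Proof. by rewrite /nonzero_entries filter_map. Qed.

Lemma nonzero_entries_id (R : realType) r (x : 'cV[R]_r) :
  (forall i, x i 0 != 0) -> nonzero_entries x = entries x.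
Proof.
by move=> xN0; apply/all_filterP/allP => _ /mapP[i _ ->].
Qed.

Lemma head_entries (R : realType) r (x : 'cV[R]_r.+1) : head 0 (entries x) = x 0 0.
Proof. by rewrite -nth0 (nth_entries x ord0). Qed.

(** The common core of both variation diminishing properties: [v] may be the vector
[A x] on its support, or [A x] with arbitrary signs given to its zeros. *)
Lemma variation_bound (R : realType) n (A : 'M[R]_n.+2) (x : 'cV[R]_n.+2)
    (v : 'I_n.+2 -> R) js :
  (forall i, x i 0 != 0) ->
  (0 < sign_changes (entries x) <= n)%N ->
  totally_negative_of_order n.+1 A ->
  sorted (@ord_lt _) js -> js != [::] ->
  {in js, forall j, v j != 0 /\ 0 <= v j * (A *m x) j 0} ->
  (sign_changes (map v js) <= sign_changes (entries x))%N /\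
  (sign_changes (map v js) = sign_changes (entries x) ->
   0 < head 0 (map v js) * head 0 (entries x) /\
   0 < last 0 (map v js) * last 0 (entries x)).
Proof.
move=> xN0 pP AN sjs jsN0 vP.
have vN0 : all (fun j => v j != 0) js by apply/allP => j /vP[].
have [t [tjs st tP]] := exists_alternating_subseq jsN0 vN0.
have srt : sorted (@ord_lt _) t := subseq_sorted (@ord_lt_trans _) tjs sjs.
set q := sign_changes (map v js) in st *; set p := sign_changes (entries x).
(* Alternating rows taken from the [d]-th one on: the offsets [0] and [1] give
   opposite conclusions. *)
have key d : (d + p <= q)%N -> 0 < (-1) ^+ d * head 0 (map v js) * x 0 0.
  move=> dpq.
  have kt (k : 'I_p.+1) : (d + k < size t)%N by rewrite st; have := ltn_ord k; lia.
  apply: (@totally_negative_alternating_rows R n A x (fun k => nth ord0 t (d + k))) => //.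
  - move=> i j ij; apply: (sorted_ltn_nth (@ord_lt_trans _) ord0 srt); rewrite ?inE ?kt //.
    by rewrite ltn_add2l.
  - by apply: contraTneq (tP ord0 d _) => [->|]; rewrite ?mul0r ?ltxx // st; lia.
  - move=> k; have := tP ord0 _ (kt k); rewrite exprD [_ ^+ d * _]mulrC => h.
    have [_ h'] := vP _ (mem_subseq tjs (mem_nth ord0 (kt k))).
    by rewrite [_ * (_ * head _ _)]mulrA; apply: mulr_ge0_trans h h'.
split=> [|qp].
  rewrite leqNgt; apply/negP => pq.
  have := key 1 pq; rewrite expr1 mulN1r mulNr oppr_gt0 ltNge ltW //.
  by have := key 0 (ltnW pq); rewrite mul1r.
have hx : 0 < head 0 (map v js) * head 0 (entries x).
  by have := key 0; rewrite qp leqnn mul1r head_entries; apply.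
split=> //.
have svN : map v js != [::] by case: (js) jsN0.
have := sign_changes_sign svN; rewrite all_map => /(_ vN0); rewrite -/q qp => h1.
have exN : entries x != [::] by rewrite -size_eq0 size_entries.
have h2 : 0 < (-1) ^+ p * head 0 (entries x) * last 0 (entries x).
  by apply: sign_changes_sign => //; apply/allP => _ /mapP[i _ ->].
rewrite mulrC in h1; apply: mulr_gt0_trans h1 _.
apply: mulr_gt0_trans h2.
by rewrite mulrACA -expr2 sqrr_sign mul1r.
Qed.

(** * Test vectors of mixed signs *)

Definition mixed_signs (R : realType) n (x : 'cV[R]_n.+2) : Prop :=
  (forall i, x i 0 != 0) /\ (0 < sign_changes (entries x) <= n)%N.

Lemma sign_changes_opp (R : realType) (s : seq R) :
  sign_changes [seq - a | a <- s] = sign_changes s.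
Proof.
rewrite !sign_changes_flips size_map; apply: eq_big_nat => i /=; rewrite ltn_predRL => im.
by rewrite !(nth_map 0) ?mulrNN // ltnW.
Qed.

(** If all products were nonpositive, [- x] would be a sign pattern compatible with
[A x] with as many sign changes as [x], but with the wrong first sign. *)
Lemma mixed_signs_non_reversal (R : realType) n (A : 'M[R]_n.+2) (x : 'cV[R]_n.+2) :
  totally_negative_of_order n.+1 A -> mixed_signs x ->
  exists i, 0 < x i 0 * (A *m x) i 0.
Proof.
move=> AN [xN0 xp]; apply/existsP; apply: contraT; rewrite negb_exists => /forallP H.
have mapE : map (fun j => - x j 0) (enum 'I_n.+2) = [seq - a | a <- entries x].
  exact: (map_comp -%R (fun i => x i 0)).
have [||_ ] := variation_bound (v := fun j => - x j 0) xN0 xp AN (sorted_enum_ord _).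
- by rewrite -size_eq0 size_enum_ord.
- move=> j _; rewrite oppr_eq0; split=> //.
  by rewrite mulNr oppr_ge0 leNgt H.
rewrite mapE sign_changes_opp => /(_ erefl)[+ _].
rewrite -mapE -nth0 (nth_map ord0) ?size_enum_ord // (nth_ord_enum _ ord0) head_entries.
by rewrite mulNr oppr_gt0 ltNge -expr2 sqr_ge0.
Qed.

Lemma mixed_signs_variation_neg (R : realType) n (A : 'M[R]_n.+2) T :
  totally_negative_of_order n.+1 A -> T `<=` @mixed_signs R n ->
  variation_diminishing_neg A T.
Proof.
move=> AN TM x /TM xM; have [i yi] := mixed_signs_non_reversal AN xM.
case: xM => xN0 xp; set y := A *m x in yi *.
(* Sign non-reversal excludes [A x = 0], where [Splus] takes its special value. *)
have yN0 : y != 0 by apply: contraTneq yi => ->; rewrite mxE mulr0 ltxx.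
have bound (e : {ffun 'I_n.+2 -> bool}) :=
  @variation_bound R n A x (fun j => assign_signs e y j 0) (enum 'I_n.+2)
    xN0 xp AN (sorted_enum_ord _).
have eN0 : enum 'I_n.+2 != [::] by rewrite -size_eq0 size_enum_ord.
have vP e : {in enum 'I_n.+2, forall j, assign_signs e y j 0 != 0 /\
    0 <= assign_signs e y j 0 * y j 0}.
  move=> j _; rewrite mxE; case: (eqVneq (y j 0) 0) => [->|yj].
    by rewrite signr_eq0 mulr0.
  by rewrite -expr2 sqr_ge0.
rewrite /Sminus nonzero_entries_id //; split=> [|eqS _ e se].
  rewrite /Splus (negbTE yN0); apply/bigmax_leqP => e _.
  exact: (bound e eN0 (vP e)).1.
by rewrite eqS in se; apply: (bound e eN0 (vP e)).2.
Qed.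

Lemma mixed_signs_variation_nonpos (R : realType) n (A : 'M[R]_n.+2) T :
  totally_negative_of_order n.+1 A -> T `<=` @mixed_signs R n ->
  variation_diminishing_nonpos A T.
Proof.
move=> AN TM x /TM[xN0 xp]; set y := A *m x.
rewrite /Sminus (nonzero_entries_id xN0) nonzero_entriesE.
set js := [seq _ <- _ | _]; have [js0|jsN0] := eqVneq js [::].
  rewrite js0; split=> // _ yN0; case: yN0; apply/matrixP => i l; rewrite ord1 [RHS]mxE.
  apply/eqP/negPn/negP => yi; have : i \in js by rewrite mem_filter yi mem_enum.
  by rewrite js0.
have [||b1 b2] := variation_bound (v := fun j => y j 0) xN0 xp AN _ jsN0.
- by apply: sorted_filter (sorted_enum_ord _); apply: ord_lt_trans.
- by move=> j; rewrite mem_filter => /andP[yj _]; rewrite -expr2 sqr_ge0.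
by split=> // /b2.
Qed.

Lemma orthant_signs (R : realType) r (eps : 'I_r -> bool) (x : 'cV[R]_r) i j :
  open_orthant eps x -> 0 < (-1) ^+ (eps i (+) eps j) * (x i 0 * x j 0).
Proof.
move=> xO; rewrite signr_addb mulrACA mulr_gt0 //; exact: xO.
Qed.

(** Without sign change the pattern would be constant, and with [n + 1] of them it
would be alternating. *)
Lemma nonalternating_mixed_signs (R : realType) n (eps : 'I_n.+2 -> bool) :
  open_orthant eps `&` alternating R n.+2 = set0 ->
  ~~ [forall i, eps i == eps ord0] ->
  open_orthant eps `<=` @mixed_signs R n.
Proof.
move=> Oalt; rewrite negb_forall => /existsP[i0 ei0] x xO.
have xN0 i : x i 0 != 0 by apply: contraTneq (xO i) => ->; rewrite mulr0 ltxx.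
pose u := nth 0 (entries x).
have uE (i : 'I_n.+2) : u i = x i 0 by rewrite /u nth_entries.
have pE : sign_changes (entries x) = flips u n.+1.
  by rewrite sign_changes_flips size_entries.
split=> //; apply/andP; split.
  rewrite lt0n; apply/eqP => p0; have fi0 : flips u i0 = 0%N.
    by apply/eqP; rewrite -leqn0 -p0 pE leq_flips // -ltnS.
  have := @flips_sign _ u i0; rewrite fi0 mul1r (uE ord0) uE.
  have := orthant_signs ord0 i0 xO.
  have -> : eps ord0 (+) eps i0 by move: ei0; case: (eps i0); case: (eps ord0).
  rewrite expr1 mulN1r oppr_gt0.
  move=> h; rewrite ltNge (ltW h) => H; suff : false by []; apply: H.
  move=> i ii0; rewrite (uE (Ordinal (leq_ltn_trans ii0 (ltn_ord i0)))) //.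
rewrite leqNgt; apply/negP => np.
suff : (open_orthant eps `&` alternating R n.+2) x by rewrite Oalt.
split=> //; split=> // i j ji.
have im : (i < n.+1)%N by rewrite -ltnS -ji.
rewrite -!uE ji; apply: flips_full im; rewrite -pE //.
Qed.

(** * Test vectors of constant sign *)

Lemma one_sign_reversal (R : realType) n (A : 'M[R]_n.+1) (x : 'cV[R]_n.+1) :
  (forall i j, A i j < 0) -> (forall i j, 0 < x i 0 * x j 0) ->
  forall i, x i 0 * (A *m x) i 0 < 0.
Proof.
move=> AN xP i; rewrite mxE mulr_sumr -oppr_gt0 -sumrN (bigD1 ord0) //=.
have t0 j : 0 < - (x i 0 * (A i j * x j 0)).
  by rewrite oppr_gt0 mulrCA nmulr_rlt0.
by rewrite ltr_pwDl ?sumr_ge0 // => j _; apply: ltW.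
Qed.

Lemma one_sign_changes (R : realType) r (x : 'cV[R]_r) :
  (forall i j, 0 < x i 0 * x j 0) -> sign_changes (entries x) = 0%N.
Proof.
move=> xP; rewrite sign_changes_flips size_entries /flips big_nat big1 // => i /andP[_ im].
have im1 : (i.+1 < r)%N by lia.
rewrite (nth_entries x (Ordinal (ltnW im1))) (nth_entries x (Ordinal im1)).
by rewrite ltNge ltW.
Qed.

Lemma one_sign_no_variation (R : realType) n (A : 'M[R]_n.+2)
    (T : set 'cV[R]_n.+2) (x : 'cV[R]_n.+2) :
  (forall i j, A i j < 0) -> (forall i j, 0 < x i 0 * x j 0) -> T x ->
  ~ variation_diminishing_neg A T /\ ~ variation_diminishing_nonpos A T.
Proof.
move=> AN xP Tx; have rev := one_sign_reversal AN xP; set y := A *m x in rev *.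
have xN0 i : x i 0 != 0 by apply: contraTneq (xP i i) => ->; rewrite mulr0 ltxx.
have yN0 i : y i 0 != 0 by apply: contraTneq (rev i) => ->; rewrite mulr0 ltxx.
have yP i j : 0 < y i 0 * y j 0.
  apply: (@mulr_gt0_trans _ (- x i 0)); first by rewrite mulrN oppr_gt0 mulrC.
  apply: (@mulr_gt0_trans _ (- x j 0)); first by rewrite mulrNN.
  by rewrite mulNr oppr_gt0.
have y0 : y <> 0 by move=> e; have := yN0 0; rewrite e mxE eqxx.
have hd : ~ 0 < head 0 (entries y) * head 0 (entries x).
  by rewrite !head_entries mulrC => h; have := rev 0; rewrite ltNge ltW.
have sx : Sminus x = 0%N by rewrite /Sminus nonzero_entries_id // one_sign_changes.
have sy : Sminus y = 0%N by rewrite /Sminus nonzero_entries_id // one_sign_changes.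
have ay e : assign_signs e y = y.
  by apply/matrixP => i j; rewrite ord1 mxE (negbTE (yN0 i)).
have spy : Splus y = 0%N.
  by rewrite /Splus; case: eqP => // _; apply: big1 => e _; rewrite ay one_sign_changes.
split=> /(_ x Tx)[_]; rewrite -/y sx.
  move=> /(_ spy y0 [ffun=> false]) /=; rewrite ay one_sign_changes // spy.
  by rewrite nonzero_entries_id // => /(_ erefl)[/hd].
by move=> /(_ sy y0)[+ _]; rewrite !nonzero_entries_id // => /hd.
Qed.

(** * The four equivalences fail *)

Lemma order1_entries (R : realType) r k (A : 'M[R]_r) :
  (0 < k)%N -> totally_negative_of_order k A -> forall i j, A i j < 0.
Proof.
move=> k0 AN i j; have := AN 1%N (fun=> i) (fun=> j).
by rewrite det_mx11 mxE; apply=> // a b; rewrite !ord1.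
Qed.

Lemma totally_negative_nonpositive (R : realType) r k (A : 'M[R]_r) :
  totally_negative_of_order k A -> totally_nonpositive_of_order k A.
Proof. by move=> AN p f g pk hf hg; apply/ltW/AN. Qed.

Lemma totally_nonpositive_det (R : realType) n (A : 'M[R]_n.+1) :
  totally_nonpositive A -> \det A <= 0.
Proof.
move=> AN; have -> : A = mxsub id id A by apply/matrixP => i j; rewrite mxE.
by apply: AN; rewrite /= ?leqnn.
Qed.

Theorem theorem6p3 (R : realType) (r : nat) (hr : (2 <= r)%N)
    (O : set 'cV[R]_r)
    (hO : exists eps : 'I_r -> bool, O = open_orthant eps)
    (hOalt : O `&` alternating R r = set0)
    (T : 'M[R]_r -> set 'cV[R]_r)
    (hTO : forall A, T A `<=` O)
    (hT0 : forall A, T A !=set0) :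
  [/\ ~ (forall A : 'M[R]_r,
           (forall i j, A i j < 0) -> totally_negative_of_order r.-1 A ->
           (totally_negative A <-> variation_diminishing_neg A (T A))),
      ~ (forall A : 'M[R]_r,
           (forall i j, A i j < 0) -> totally_negative_of_order r.-1 A ->
           (totally_negative A <-> sign_non_reversal A (T A))),
      ~ (forall A : 'M[R]_r,
           (forall i j, A i j <= 0) -> totally_nonpositive_of_order r.-1 A ->
           (totally_nonpositive A <-> variation_diminishing_nonpos A (T A))) &
      ~ (forall A : 'M[R]_r,
           (forall i j, A i j <= 0) -> totally_nonpositive_of_order r.-1 A ->
           (totally_nonpositive A <-> nonstrict_sign_non_reversal A (T A)))].
Proof.
case: hO hOalt hTO => eps -> hOalt hTO.
case: r hr => [|[|n]] // _ in eps O T hOalt hTO hT0 *.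
have [const|nconst] := boolP [forall i, eps i == eps ord0].
  have [N NN] := exists_totally_negative R n.+1.
  have NN1 : totally_negative_of_order n.+1 N.
    by move=> p f g /andP[p0 pn]; apply: NN; rewrite p0 leqW.
  have NP := totally_negative_nonpositive NN.
  have NP1 := totally_negative_nonpositive NN1.
  have N0 := order1_entries (ltn0Sn n) NN1.
  have N0w i j := ltW (N0 i j).
  have [x Tx] := hT0 N.
  have xP i j : 0 < x i 0 * x j 0.
    have := orthant_signs i j (hTO _ _ Tx).
    by rewrite (eqP (forallP const i)) (eqP (forallP const j)) addbb mul1r.
  have [noneg nononpos] := one_sign_no_variation N0 xP Tx.
  have x0 : x <> 0 by move=> e; have := xP 0 0; rewrite e mxE mulr0 ltxx.
  have rev := one_sign_reversal N0 xP.
  split=> H.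
  - by apply: noneg; apply/H.
  - have [/(_ NN)/(_ x Tx x0)[i] + _] := H N N0 NN1.
    by rewrite ltNge ltW.
  - by apply: nononpos; apply/H.
  - have [/(_ NP)/(_ x Tx x0)[i [_]] + _] := H N N0w NP1.
    by rewrite leNgt rev.
have [A [AN detA]] := exists_almost_totally_negative R n.
have AP := totally_negative_nonpositive AN.
have A0 := order1_entries (ltn0Sn n) AN.
have A0w i j := ltW (A0 i j).
have TM : T A `<=` @mixed_signs R n.
  by move=> x /hTO; apply: nonalternating_mixed_signs.
have notTNP : ~ totally_nonpositive A.
  by move=> /totally_nonpositive_det; rewrite leNgt detA.
have notTN : ~ totally_negative A by move=> /totally_negative_nonpositive.
split=> H.
- by apply: notTN; apply/H => //; apply: mixed_signs_variation_neg.
- apply: notTN; apply/H => // x /TM xM _; exact: mixed_signs_non_reversal.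
- by apply: notTNP; apply/H => //; apply: mixed_signs_variation_nonpos.
- apply: notTNP; apply/H => // x /TM xM _.
  have [i xi] := mixed_signs_non_reversal AN xM; exists i.
  by split; [case: xM|apply: ltW].
Qed.
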